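(* Let $n,m,T,N\in\mathbb{N}^+$, let $A\in\mathbb{R}^{n\times n}$ and $B\in\mathbb{R}^{n\times m}$ with $(A,B)$ controllable and $\operatorname{Rank}(B)=m$. Let $X_0\in\mathbb{R}^{n\times N}$, $X\in\mathbb{R}^{nT\times N}$, $U\in\mathbb{R}^{mT\times N}$ be data matrices collected from $N$ trajectories of length $T$ of $x(t+1)=Ax(t)+Bu(t)$ (as described in the context), and assume persistency of excitation, i.e. $\operatorname{Rank}\begin{bmatrix}X_0 \\ U\end{bmatrix}=mT+n$. Let $K_U$ be a matrix whose columns form a basis of $\operatorname{Ker}(U)$ and $K_0$ a matrix whose columns form a basis of $\operatorname{Ker}(X_0)$. Let $\lambda_i\in\mathbb{R}$ be a desired closed-loop eigenvalue, and let $\mathcal{P}_i\subseteq\mathbb{R}^n$ be the allowable eigenvector subspace associated with $\lambda_i$, i.e. the set of all $\upsilon\in\mathbb{R}^n$ such that $(A-BK)\upsilon=\lambda_i\upsilon$ for some $K\in\mathbb{R}^{m\times n}$. Then $$\mathcal{P}_i = X_0K_U\begin{bmatrix}I & 0\end{bmatrix}\operatorname{Ker}\left(\begin{bmatrix}XK_U-W\Lambda_iX_0K_U & XK_0\end{bmatrix}\right),$$ so that, for every $K\in\mathbb{R}^{m\times n}$, any eigenvector of $A-BK$ associated with $\lambda_i$ belongs to the subspace on the right-hand side.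
   Context: Data: for each experiment $j\in\{1,\dots,N\}$, an initial state $x^j(0)\in\mathbb{R}^n$ and inputs $u^j(0),\dots,u^j(T-1)\in\mathbb{R}^m$ are given, and the states satisfy $x^j(t+1)=Ax^j(t)+Bu^j(t)$ for $t=0,\dots,T-1$. Let $\mathbf{x}^j_T\in\mathbb{R}^{nT}$ be the stacked column vector of $x^j(1),\dots,x^j(T)$ and $\mathbf{u}^j_T\in\mathbb{R}^{mT}$ the stacked column vector of $u^j(0),\dots,u^j(T-1)$. Then $X_0=\begin{bmatrix}x^1(0)&\cdots&x^N(0)\end{bmatrix}$, $X=\begin{bmatrix}\mathbf{x}^1_T&\cdots&\mathbf{x}^N_T\end{bmatrix}$, $U=\begin{bmatrix}\mathbf{u}^1_T&\cdots&\mathbf{u}^N_T\end{bmatrix}$. Notation: $\Lambda_i=\begin{bmatrix}I&\lambda_iI&\lambda_i^2I&\cdots&\lambda_i^TI\end{bmatrix}^\top\in\mathbb{R}^{n(T+1)\times n}$ with $I=I_n$, and $W=\begin{bmatrix}0_{nT\times n}&I_{nT}\end{bmatrix}$, so that $W\Lambda_i$ is the vertical stack of $\lambda_iI_n,\lambda_i^2I_n,\dots,\lambda_i^TI_n$. In $\begin{bmatrix}I&0\end{bmatrix}$, the identity block has as many columns as $K_U$ and the zero block as many columns as $K_0$; i.e. this matrix extracts $\alpha$ from $\begin{bmatrix}\alpha \\ \beta\end{bmatrix}$, where $\alpha$ multiplies the columns of $K_U$ and $\beta$ those of $K_0$. For a matrix $M$ and a subspace $\mathcal{S}$, $M\mathcal{S}=\{Ms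 : s\in\mathcal{S}\}$. *)

(* Defs.v *)
From mathcomp Require Import all_boot all_order all_algebra.
From mathcomp Require Import boolp classical_sets reals.

Set Implicit Arguments.
Unset Strict Implicit.
Unset Printing Implicit Defensive.

Import Order.TTheory GRing.Theory Num.Theory.
Local Open Scope ring_scope.

Section LinearSystems.
Context {R : realType}.

(* Only x 0, ..., x T and u 0, ..., u (T-1) are constrained; the values of
   the sequences beyond the horizon play no role. *)
Definition is_trajectory (n m : nat) (A : 'M[R]_n) (B : 'M[R]_(n, m))
    (T : nat) (x : nat -> 'cV[R]_n) (u : nat -> 'cV[R]_m) : Prop :=
  forall t : nat, (t < T)%N -> x t.+1 = A *m x t + B *m u t.

Definition controllable (n m : nat) (A : 'M[R]_n) (B : 'M[R]_(n, m)) : Prop :=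
  forall xi xf : 'cV[R]_n,
    exists (k : nat) (x : nat -> 'cV[R]_n) (u : nat -> 'cV[R]_m),
      [/\ is_trajectory A B k x u, x 0%N = xi & x k = xf].

(* MathComp's kermx and %MS subspaces are about row vectors; the subspaces
   of column vectors are taken here in {vspace 'cV_n}. *)
Definition Ker (p q : nat) (M : 'M[R]_(p, q)) : {vspace 'cV[R]_q} :=
  lker (linfun (mulmx M : 'cV[R]_q -> 'cV[R]_p)).

Definition mximage (p q : nat) (M : 'M[R]_(p, q)) (S : {vspace 'cV[R]_q}) :
    {vspace 'cV[R]_p} :=
  (linfun (mulmx M : 'cV[R]_q -> 'cV[R]_p) @: S)%VS.

Definition columns_basis (q k : nat) (S : {vspace 'cV[R]_q})
    (M : 'M[R]_(q, k)) : bool :=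
  basis_of S [seq col j M | j <- enum 'I_k].

Definition of_columns (p N : nat) (c : 'I_N -> 'cV[R]_p) : 'M[R]_(p, N) :=
  \matrix_(i < p, j < N) c j i 0.

(* The T * n rows of a stack of T blocks of height n are indexed by
   'I_(\sum_(t < T) n), the row index type of \mxcol. *)
Definition stack (n T : nat) (z : nat -> 'cV[R]_n) :
    'cV[R]_(\sum_(t < T) n) :=
  \mxcol_(t < T) z t.

Definition Lambda (n T : nat) (lambda : R) :
    'M[R]_(\sum_(t < T.+1) n, n) :=
  \mxcol_(t < T.+1) (lambda ^+ t)%:M.

(* [0 I], its n + \sum_(t < T) n columns being reindexed by
   'I_(\sum_(t < T.+1) n) to match Lambda. *)
Definition W (n T : nat) : 'M[R]_(\sum_(t < T) n, \sum_(t < T.+1) n) :=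
  castmx (erefl, @mxsize_recl T (fun=> n)) (row_mx 0 1%:M).

Definition is_eigenvector (n : nat) (M : 'M[R]_n) (lambda : R)
    (v : 'cV[R]_n) : Prop :=
  v != 0 /\ M *m v = lambda *: v.

Local Open Scope classical_set_scope.

Definition allowable_eigenvectors (n m : nat) (A : 'M[R]_n)
    (B : 'M[R]_(n, m)) (lambda : R) : set 'cV[R]_n :=
  [set v | exists K : 'M[R]_(m, n), (A - B *m K) *m v = lambda *: v].

End LinearSystems.

(* Main.v *)
Require Import Defs.
From mathcomp Require Import all_boot all_order all_algebra.
From mathcomp Require Import boolp classical_sets reals.

Import Order.TTheory GRing.Theory Num.Theory.
Local Open Scope ring_scope.
Local Open Scope classical_set_scope.

(** Linear combinations of trajectories are trajectories, and persistency of
excitation makes every initial state and input sequence over the horizon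
available as the combination of the data with some weight vector [w].
Moreover [w] splits as [g + h] with [U g = 0] and [X0 h = 0], i.e. as a free
response plus a forced response. The kernel condition says that the combined
trajectory is [t |-> lambda ^ t v] with [v = X0 g]; its first step reads
[lambda v = A v + B u0], and [u0 = - K v] is solvable in [K] as soon as
[v <> 0]. Conversely, feeding back [- K v lambda ^ t] from an eigenvector [v]
of [A - B K] produces exactly that trajectory. *)

Lemma mem_Ker {R : realType} {p q : nat} (M : 'M[R]_(p, q)) (v : 'cV[R]_q) :
  (v \in Ker M) = (M *m v == 0).
Proof. by rewrite memv_ker lfunE. Qed.

Lemma mem_mximageP {R : realType} {p q : nat} (M : 'M[R]_(p, q))
    (S : {vspace 'cV[R]_q}) (v : 'cV[R]_p) :
  reflect (exists2 c, c \in S & v = M *m c) (v \in mximage M S).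
Proof.
by apply: (iffP memv_imgP) => -[c cS ->]; exists c; rewrite ?lfunE.
Qed.

Lemma mulmx_sum_scale_col {R : comPzRingType} {p q : nat} (M : 'M[R]_(p, q))
    (a : 'cV[R]_q) : M *m a = \sum_j a j 0 *: col j M.
Proof.
apply/matrixP => i k; rewrite !mxE summxE ord1.
by apply: eq_bigr => j _; rewrite !mxE mulrC.
Qed.

Lemma columns_basisP {R : realType} {q k : nat} {S : {vspace 'cV[R]_q}}
    {M : 'M[R]_(q, k)} (basisM : columns_basis S M) (v : 'cV[R]_q) :
  reflect (exists a, v = M *m a) (v \in S).
Proof.
rewrite -(span_basis basisM); apply: (iffP idP) => [|[a ->]].
  have size_cols : size [seq col j M | j <- enum 'I_k] == k.
    by rewrite size_map size_enum_ord.
  (* The list of columns is repackaged as a [k]-tuple, since [coord] reads coordinates relative to a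
     tuple. *)
  rewrite -[X in <<X>>%VS]/(tval (Tuple size_cols)) => /coord_span v_sum.
  exists (\col_i coord (Tuple size_cols) i v).
  rewrite [LHS]v_sum mulmx_sum_scale_col; apply: eq_bigr => i _.
  by rewrite mxE (nth_map i) ?size_enum_ord // nth_ord_enum.
rewrite mulmx_sum_scale_col; apply: memv_suml => j _; apply: memvZ.
by apply/memv_span/map_f; rewrite mem_enum.
Qed.

Definition combination {R : realType} {p N : nat} (w : 'cV[R]_N)
    (z : 'I_N -> nat -> 'cV[R]_p) (t : nat) : 'cV[R]_p :=
  \sum_j w j 0 *: z j t.

Lemma mul_of_columns {R : realType} {p N : nat} (c : 'I_N -> 'cV[R]_p)
    (w : 'cV[R]_N) : of_columns c *m w = \sum_j w j 0 *: c j.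
Proof.
rewrite mulmx_sum_scale_col; apply: eq_bigr => j _; congr (_ *: _).
by apply/colP => i; rewrite !mxE.
Qed.

Lemma mul_stack_columns {R : realType} {p N : nat} (T : nat)
    (z : 'I_N -> nat -> 'cV[R]_p) (w : 'cV[R]_N) :
  of_columns (fun j => stack T (z j)) *m w = stack T (combination w z).
Proof.
rewrite mul_of_columns; apply/colP => i; rewrite /combination /stack !mxE !summxE.
by apply: eq_bigr => j _; rewrite !mxE.
Qed.

Lemma eq_stackP {R : realType} {p T : nat} (y z : nat -> 'cV[R]_p) :
  (forall t, (t < T)%N -> y t = z t) <-> stack T y = stack T z.
Proof.
rewrite /stack -eq_mxcolP; split=> [yz [t tT]|yz t tT]; first exact: yz.
exact: (yz (Ordinal tT)).
Qed.

(** Both casts disappear once [q'] is identified with [q], whatever the proofs [e] and [e']. This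
    cancels the reindexing in [W] against the one that comes with splitting off the first block of
    [Lambda]. *)
Lemma mulmx_castmx {R : pzSemiRingType} {p q q' r : nat} (e e' : q = q')
    (M : 'M[R]_(p, q)) (M' : 'M[R]_(q, r)) :
  castmx (erefl, e) M *m castmx (e', erefl) M' = M *m M'.
Proof. by case: q' / e e' => e'; rewrite !castmx_id. Qed.

Lemma mul_W_Lambda {R : realType} (n T : nat) (lambda : R) (v : 'cV[R]_n) :
  W n T *m Lambda n T lambda *m v = stack T (fun t => lambda ^+ t.+1 *: v).
Proof.
have -> : W n T *m Lambda n T lambda = \mxcol_(t < T) (lambda ^+ t.+1)%:M.
  (* The zero block of [W] kills the top block [lambda ^+ 0] of [Lambda], so the remaining exponents
     start at 1. *)
  by rewrite /W /Lambda mxcol_recu mulmx_castmx mul_row_col mul0mx add0r mul1mx.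
by rewrite mxcol_mul; apply/eq_mxcol => t; rewrite mul_scalar_mx.
Qed.

Lemma is_trajectory_combination {R : realType} {n m T N : nat}
    {A : 'M[R]_n} {B : 'M[R]_(n, m)}
    {x : 'I_N -> nat -> 'cV[R]_n} {u : 'I_N -> nat -> 'cV[R]_m}
    (xu : forall j, is_trajectory A B T (x j) (u j)) (w : 'cV[R]_N) :
  is_trajectory A B T (combination w x) (combination w u).
Proof.
move=> t tT; rewrite /combination !mulmx_sumr -big_split /=.
by apply: eq_bigr => j _; rewrite xu // scalerDr -!scalemxAr.
Qed.

Lemma is_trajectory_unique {R : realType} {n m T : nat}
    {A : 'M[R]_n} {B : 'M[R]_(n, m)} {x y : nat -> 'cV[R]_n}
    {u v : nat -> 'cV[R]_m}
    (xu : is_trajectory A B T x u) (yv : is_trajectory A B T y v)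
    (xy0 : x 0%N = y 0%N) (uv : forall t, (t < T)%N -> u t = v t) :
  forall t, (t <= T)%N -> x t = y t.
Proof.
by elim=> // t IHt tT; rewrite xu // yv // IHt ?(ltnW tT) // uv.
Qed.

(** A nonzero column has full column rank, hence a left inverse [v'], and [K := w *m v'] sends [v]
    to [w]. *)
Lemma mulmx_col_surjective {F : fieldType} {n m : nat} {v : 'cV[F]_n}
    (v_neq0 : v != 0) (w : 'cV[F]_m) : exists K : 'M[F]_(m, n), K *m v = w.
Proof.
have /row_fullP[v' v'v] : row_full v.
  by rewrite /row_full eqn_leq rank_leq_col lt0n mxrank_eq0.
by exists (w *m v'); rewrite -mulmxA v'v mulmx1.
Qed.

Theorem mainTheorem1 (R : realType) (n m T N : nat)
    (n_gt0 : (0 < n)%N) (m_gt0 : (0 < m)%N) (T_gt0 : (0 < T)%N)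
    (N_gt0 : (0 < N)%N)
    (A : 'M[R]_n) (B : 'M[R]_(n, m))
    (AB_controllable : controllable A B) (rank_B : \rank B = m)
    (x : 'I_N -> nat -> 'cV[R]_n) (u : 'I_N -> nat -> 'cV[R]_m)
    (xu_trajectories : forall j : 'I_N, is_trajectory A B T (x j) (u j))
    (X0 : 'M[R]_(n, N)) (X : 'M[R]_(\sum_(t < T) n, N))
    (U : 'M[R]_(\sum_(t < T) m, N))
    (X0_data : X0 = of_columns (fun j => x j 0%N))
    (X_data : X = of_columns (fun j => stack T (fun t => x j t.+1)))
    (U_data : U = of_columns (fun j => stack T (u j)))
    (persistency_of_excitation : \rank (col_mx X0 U) = (m * T + n)%N)
    (p q : nat) (K_U : 'M[R]_(N, p)) (K_0 : 'M[R]_(N, q))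
    (K_U_basis : columns_basis (Ker U) K_U)
    (K_0_basis : columns_basis (Ker X0) K_0)
    (lambda : R) :
  let S : {vspace 'cV[R]_n} :=
    mximage (X0 *m K_U *m row_mx (1%:M : 'M[R]_p) (0 : 'M[R]_(p, q)))
      (Ker (row_mx (X *m K_U - W n T *m Lambda n T lambda *m X0 *m K_U)
                   (X *m K_0))) in
  allowable_eigenvectors A B lambda = [set` S] /\
  (forall (K : 'M[R]_(m, n)) (v : 'cV[R]_n),
     is_eigenvector (A - B *m K) lambda v -> v \in S).
Proof.
move=> S.
(* Membership in [S] freed of the chosen bases: [g] and [h] stand for [K_U *m a] and [K_0 *m b],
   where [a] and [b] are the two blocks of a kernel vector. *)
have memS v : reflect (exists g h, [/\ U *m g = 0, X0 *m h = 0, X0 *m g = v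
    & X *m (g + h) = stack T (fun t => lambda ^+ t.+1 *: v)]) (v \in S).
  apply: (iffP (mem_mximageP _ _ _)) => [[c]|[g [h [Ug X0h X0g Xgh]]]].
    rewrite mem_Ker -[c]vsubmxK; set a := usubmx c; set b := dsubmx c.
    rewrite mul_row_col -[_ *m row_mx _ _ *m _]mulmxA mul_row_col.
    rewrite mul1mx mul0mx addr0 => /eqP eq0 ->.
    exists (K_U *m a), (K_0 *m b).
    split; last 2 first.
    - by rewrite mulmxA.
    - apply/eqP; rewrite -subr_eq0 -mul_W_Lambda -eq0.
      by rewrite mulmxBl mulmxDr !mulmxA addrAC.
    - by apply/eqP; rewrite -mem_Ker; apply/(columns_basisP K_U_basis); exists a.
    - by apply/eqP; rewrite -mem_Ker; apply/(columns_basisP K_0_basis); exists b.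
  have /(columns_basisP K_U_basis)[a ga] : g \in Ker U by rewrite mem_Ker Ug.
  have /(columns_basisP K_0_basis)[b hb] : h \in Ker X0 by rewrite mem_Ker X0h.
  exists (col_mx a b); last first.
    by rewrite -mulmxA mul_row_col mul1mx mul0mx addr0 -mulmxA -ga X0g.
  rewrite mem_Ker mul_row_col mulmxBl -!mulmxA -ga -hb X0g [W n T *m _]mulmxA.
  by rewrite mul_W_Lambda -Xgh mulmxDr addrAC subrr.
have dataE w : [/\ X0 *m w = combination w x 0%N,
    X *m w = stack T (fun t => combination w x t.+1)
    & U *m w = stack T (combination w u)].
  by rewrite X0_data X_data U_data mul_of_columns !mul_stack_columns.
have surjective (v : 'cV[R]_n) (y : 'cV[R]_(\sum_(t < T) m)) :
    exists w, X0 *m w = v /\ U *m w = y.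
  (* The assumed rank is the number of rows, so the data matrix has a right inverse [D]. *)
  have /row_freeP[D XUD] : row_free (col_mx X0 U).
    rewrite /row_free persistency_of_excitation sum_nat_const card_ord.
    by rewrite addnC mulnC.
  exists (D *m col_mx v y); apply: eq_col_mx.
  by rewrite -mul_col_mx mulmxA XUD mul1mx.
have allowable_sub v K : (A - B *m K) *m v = lambda *: v -> v \in S.
  move=> eigen; apply/memS.
  pose u' t := - (lambda ^+ t *: (K *m v)).
  have [w [X0w Uw]] := surjective v (stack T u').
  (* The weights [g] realize the free response from [v]; then [w - g] starts from 0 and carries all
     of the input. *)
  have [g [X0g Ug]] := surjective v 0.
  exists g, (w - g); split=> //; first by rewrite mulmxBr X0w X0g subrr.
  have [w0 Xw Uw'] := dataE w.
  rewrite addrC subrK Xw; apply/eq_stackP => t tT.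
  have yu' : is_trajectory A B T (fun t => lambda ^+ t *: v) u'.
    move=> s _; rewrite mulmxN -!scalemxAr -scalerBr exprSr -scalerA -eigen.
    by rewrite mulmxBl mulmxA.
  (* Both trajectories start at [v] under the same inputs; they are compared at time [t.+1], which
     is at most [T]. *)
  apply: (is_trajectory_unique (is_trajectory_combination xu_trajectories w) yu')=> //.
    by rewrite -w0 X0w scale1r.
  by apply/eq_stackP; rewrite -Uw'.
split; last by move=> K v [_ /allowable_sub].
apply/seteqP; split=> v /=; first by case=> K /allowable_sub.
move=> /memS[g [h [Ug X0h X0g Xgh]]].
have [w0 Xw _] := dataE (g + h).
have x0 : combination (g + h) x 0%N = v by rewrite -w0 mulmxDr X0h addr0.
(* Block 0 of the stack, present because [T] is positive, holds the state at time 1. *)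
move: Xgh; rewrite Xw => /eq_stackP/(_ _ T_gt0); rewrite expr1.
rewrite (is_trajectory_combination xu_trajectories) // x0 => step.
(* For [v = 0] every gain works, so 0 is taken; otherwise [K] is chosen to reproduce the first
   input. *)
have [v0|v_neq0] := eqVneq v 0.
  by exists 0; rewrite v0 mulmx0 scaler0.
have [K Kv] := mulmx_col_surjective v_neq0 (- combination (g + h) u 0%N).
by exists K; rewrite mulmxBl -mulmxA Kv mulmxN opprK.
Qed.
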